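(* Let $q$ be a prime with $q\equiv 3\pmod 4$, $m\ge 3$ an integer, and $n=q^m$. Then the line graph $L(\overline{\Gamma(\mathbb{Z}_n[i])})$ of the complement of the zero-divisor graph of $\mathbb{Z}_n[i]$ is pancyclic.
   Context: $\mathbb{Z}_n[i]=\mathbb{Z}[i]/\langle n\rangle=\{a+bi : a,b\in\mathbb{Z}_n\}$ with $i^2=-1$. For a finite commutative ring $R$ with unity, $\Gamma(R)$ has vertex set the nonzero zero-divisors of $R$, distinct $x,y$ adjacent iff $xy=0$. $\overline{G}$ is the complement graph of $G$. The line graph $L(G)$ has the edges of $G$ as vertices, two being adjacent iff they share an endpoint in $G$. A graph of order $N$ is pancyclic if $N\ge 3$ and it contains a cycle of length $k$ for every $3\le k\le N$. *)

(* Defs.v *)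
From HB Require Import structures.
From mathcomp Require Import all_boot all_order all_algebra.
From mathcomp Require Import ring.

Set Implicit Arguments.
Unset Strict Implicit.
Unset Printing Implicit Defensive.

Import GRing.Theory.
Local Open Scope ring_scope.

Record sgraph := SGraph {
  svertex :> finType;
  sadj : rel svertex;
  sadj_sym : symmetric sadj;
  sadj_irr : irreflexive sadj
}.

Section GraphOperations.
Variable G : sgraph.

Definition compl_adj : rel G := fun x y => (x != y) && ~~ sadj x y.

Fact compl_adj_sym : symmetric compl_adj.
Proof. by move=> x y; rewrite /compl_adj eq_sym sadj_sym. Qed.

Fact compl_adj_irr : irreflexive compl_adj.
Proof. by move=> x; rewrite /compl_adj eqxx. Qed.

Definition compl_graph : sgraph := SGraph compl_adj_sym compl_adj_irr.

Definition edges : {set {set G}} :=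
  [set e : {set G} | [exists x, exists y, sadj x y && (e == [set x; y])]].

Definition line_adj : rel {e : {set G} | e \in edges} :=
  fun e f => (e != f) && (val e :&: val f != set0).

Fact line_adj_sym : symmetric line_adj.
Proof. by move=> e f; rewrite /line_adj eq_sym setIC. Qed.

Fact line_adj_irr : irreflexive line_adj.
Proof. by move=> e; rewrite /line_adj eqxx. Qed.

Definition line_graph : sgraph := SGraph line_adj_sym line_adj_irr.

(* For k >= 3, a duplicate-free cyclic sequence of k pairwise-consecutive     *)
(* adjacent vertices is exactly a k-cycle.                                    *)
Definition has_cycle_of_length (k : nat) : Prop :=
  exists c : seq G, size c = k /\ ucycle (@sadj G) c.

Definition pancyclic : Prop :=
  (3 <= #|G|)%N /\ forall k : nat, (3 <= k <= #|G|)%N -> has_cycle_of_length k.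

End GraphOperations.

Section ZeroDivisorGraph.
Variable R : finComNzRingType.

Definition nz_zero_divisor (x : R) : bool :=
  (x != 0) && [exists y : R, (y != 0) && (x * y == 0)].

Definition zdiv_adj : rel {x : R | nz_zero_divisor x} :=
  fun x y => (x != y) && (val x * val y == 0).

Fact zdiv_adj_sym : symmetric zdiv_adj.
Proof. by move=> x y; rewrite /zdiv_adj eq_sym mulrC. Qed.

Fact zdiv_adj_irr : irreflexive zdiv_adj.
Proof. by move=> x; rewrite /zdiv_adj eqxx. Qed.

Definition zero_divisor_graph : sgraph := SGraph zdiv_adj_sym zdiv_adj_irr.

End ZeroDivisorGraph.

(* The ring Z_n[i], with GaussZ a b standing for a + b i. A fresh record is   *)
(* used, rather than an alias of the pair type, because the product of two    *)
(* rings carries a canonical componentwise multiplication. As 'Z_n is Z/2Z    *)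
(* for n < 2, only n > 1 is meaningful.                                       *)
Record gaussZ (n : nat) := GaussZ { gre : 'Z_n; gim : 'Z_n }.

Section GaussianIntegersModN.
Variable n : nat.
Implicit Types x y z : gaussZ n.

Definition pair_of_gaussZ x : 'Z_n * 'Z_n := (gre x, gim x).
Definition gaussZ_of_pair (p : 'Z_n * 'Z_n) : gaussZ n := GaussZ p.1 p.2.

Fact pair_of_gaussZK : cancel pair_of_gaussZ gaussZ_of_pair.
Proof. by case. Qed.

HB.instance Definition _ := Finite.copy (gaussZ n) (can_type pair_of_gaussZK).

Definition gaussZ_zero : gaussZ n := GaussZ 0 0.
Definition gaussZ_one : gaussZ n := GaussZ 1 0.
Definition gaussZ_opp x : gaussZ n := GaussZ (- gre x) (- gim x).
Definition gaussZ_add x y : gaussZ n := GaussZ (gre x + gre y) (gim x + gim y).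
Definition gaussZ_mul x y : gaussZ n :=
  GaussZ (gre x * gre y - gim x * gim y) (gre x * gim y + gim x * gre y).

Fact gaussZ_addA : associative gaussZ_add.
Proof. by move=> x y z; congr GaussZ; apply: addrA. Qed.

Fact gaussZ_addC : commutative gaussZ_add.
Proof. by move=> x y; congr GaussZ; apply: addrC. Qed.

Fact gaussZ_add0 : left_id gaussZ_zero gaussZ_add.
Proof. by case=> a b; congr GaussZ; apply: add0r. Qed.

Fact gaussZ_addN : left_inverse gaussZ_zero gaussZ_opp gaussZ_add.
Proof. by move=> x; congr GaussZ; apply: addNr. Qed.

HB.instance Definition _ := GRing.isZmodule.Build (gaussZ n)
  gaussZ_addA gaussZ_addC gaussZ_add0 gaussZ_addN.

Fact gaussZ_mulA : associative gaussZ_mul.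
Proof. by move=> x y z; congr GaussZ; rewrite /=; ring. Qed.

Fact gaussZ_mulC : commutative gaussZ_mul.
Proof. by move=> x y; congr GaussZ; rewrite /=; ring. Qed.

Fact gaussZ_mul1 : left_id gaussZ_one gaussZ_mul.
Proof. by case=> a b; congr GaussZ; rewrite /= !mul1r !mul0r ?subr0 ?addr0. Qed.

Fact gaussZ_mulD : left_distributive gaussZ_mul gaussZ_add.
Proof. by move=> x y z; congr GaussZ; rewrite /=; ring. Qed.

Fact gaussZ_oner_neq0 : gaussZ_one != 0.
Proof. by apply/eqP => -[] /eqP; rewrite oner_eq0. Qed.

HB.instance Definition _ := GRing.Zmodule_isComNzRing.Build (gaussZ n)
  gaussZ_mulA gaussZ_mulC gaussZ_mul1 gaussZ_mulD gaussZ_oner_neq0.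

Definition gaussZ_i : gaussZ n := GaussZ 0 1.

Fact gaussZ_sqr_i : gaussZ_i * gaussZ_i = -1.
Proof. by congr GaussZ; rewrite /= !mul0r ?mul1r ?mulr0 ?sub0r ?addr0 ?oppr0. Qed.

End GaussianIntegersModN.

(* Main.v *)
(** The ring Z_n[i] is a finite chain ring: for q = 3 mod 4 the norm a^2 + b^2 is
    divisible by q only if both a and b are, so every element is a unit or a
    multiple of q. In a chain ring xy <> 0 whenever x^2 and y^2 are nonzero, and
    conversely xy <> 0 forces x^2 <> 0 or y^2 <> 0. Hence the zero-divisors with
    nonzero square form a clique K of the complement graph that meets every edge.
    Cycles inside K give cycles of the line graph of every length up to #|K|, and
    a cycle of the line graph that passes through every vertex of K can absorb
    any further edge between two consecutive edges meeting at its endpoint in K. *)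

Require Import Defs.
From mathcomp Require Import all_boot all_order all_algebra.
From mathcomp Require Import zify finfield.

Set Implicit Arguments.
Unset Strict Implicit.
Unset Printing Implicit Defensive.

Import GRing.Theory.

(** With [x] rotated to the front, its neighbours are the two ends of the remaining list, which has
    at least two distinct elements. *)
Lemma next_neq_prev (T : eqType) (s : seq T) (x : T) :
  uniq s -> 2 < size s -> x \in s -> next s x != prev s x.
Proof.
move=> uniq_s s_gt2 xs; have [i s1 def_s] := rot_to xs.
rewrite -(next_rot i) // -(prev_rot i) //.
move: uniq_s s_gt2; rewrite -(rot_uniq i) -(size_rot i) {}def_s.
case: s1 => [|y [|z s1]] //= /and3P[x_s1 y_s1 _] _.
rewrite eqxx; move: x_s1; rewrite !in_cons !negb_or.
move=> /and3P[/negPf-> /negPf-> x_s1].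
have -> : prev_at x x z s1 = last z s1.
  elim: s1 z x_s1 {y_s1} => [|w s1 IHs] z /=; first by rewrite eqxx.
  by rewrite in_cons negb_or => /andP[/negPf-> /IHs].
by apply: contraNneq y_s1 => ->; exact: mem_last.
Qed.

(** * Cycles in a line graph, recorded with their turning vertices *)

Section LineGraphSplit.
Variable G : sgraph.
Implicit Types (e f : {set G}) (x y : G) (p : seq ({set G} * G)).

(* A pair (e, x) in a cycle of L(G) records an edge e of G together with a
   vertex x that e shares with the next edge of the cycle. *)
Definition turn_rel : rel ({set G} * G) :=
  fun a b => [&& a.1 != b.1, a.2 \in a.1 & a.2 \in b.1].

Definition turn_cycle p :=
  [/\ cycle turn_rel p, uniq (unzip1 p) & {subset unzip1 p <= edges G}].

Lemma edgesP e :
  reflect (exists x y, sadj x y /\ e = [set x; y]) (e \in edges G).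
Proof.
rewrite inE; apply: (iffP existsP) => [[x /existsP[y /andP[xy /eqP ->]]]|].
  by exists x, y.
by move=> [x [y [xy ->]]]; exists x; apply/existsP; exists y; rewrite xy eqxx.
Qed.

Lemma turn_cycle_has_cycle p :
  turn_cycle p -> has_cycle_of_length (line_graph G) (size p).
Proof.
case=> cyc_p uniq_p sub_p.
have /all_sigP[c def_c]: all [in edges G] (unzip1 p) by apply/allP.
exists c; split; first by rewrite -(size_map val) -def_c size_map.
rewrite /ucycle -(map_inj_uniq val_inj) -def_c uniq_p andbT.
have: cycle [rel e f | (e != f) && (e :&: f != set0)] (unzip1 p).
  rewrite cycle_map; apply: sub_cycle cyc_p => a b /and3P[/= -> xa xb] /=.
  by apply/set0Pn; exists a.2; rewrite inE xa.
by rewrite def_c cycle_map.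
Qed.

(** If [f] and its successor turn at [x], both share [x] with [e], so [e] fits between them. *)
Lemma turn_cycle_insert p e x :
    turn_cycle p -> e \in edges G -> e \notin unzip1 p ->
    x \in e -> x \in unzip2 p ->
  exists2 p', turn_cycle p' &
    size p' = (size p).+1 /\ {subset unzip2 p <= unzip2 p'}.
Proof.
move=> [cyc_p uniq_p sub_p] e_edge e_new xe /mapP[[f x'] /= fx_p def_x].
rewrite -{}def_x {x'} in fx_p.
have [i p1 def_p1] := rot_to fx_p.
have rot1 : rot i (unzip1 p) = f :: unzip1 p1 by rewrite -map_rot def_p1.
have rot2 : rot i (unzip2 p) = x :: unzip2 p1 by rewrite -map_rot def_p1.
have mem1 : unzip1 p =i f :: unzip1 p1 by move=> g; rewrite -rot1 mem_rot.
have mem2 : unzip2 p =i x :: unzip2 p1 by move=> y; rewrite -rot2 mem_rot.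
rewrite mem1 in e_new.
have {}cyc_p : cycle turn_rel ((f, x) :: p1) by rewrite -def_p1 rot_cycle.
rewrite -(rot_uniq i) rot1 /= in uniq_p.
exists ((f, x) :: (e, x) :: p1); last first.
  split=> [|y]; first by rewrite -(size_rot i p) def_p1.
  by rewrite mem2 !inE => /orP[->|->]; rewrite ?orbT.
split=> [||g]; last first.
- rewrite /= !in_cons => /or3P[/eqP->|/eqP->//|g_p1]; apply: sub_p; rewrite mem1.
    exact: mem_head.
  by rewrite in_cons g_p1 orbT.
- move: e_new; rewrite /= !inE negb_or eq_sym => /andP[/negPf-> ->].
  by rewrite orFb.
(* A single pair is no turn cycle, since [turn_rel] is irreflexive. *)
case: p1 cyc_p e_new {def_p1 rot1 rot2 mem1 mem2 uniq_p} => [|[g y] p1] /=.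
  by rewrite /turn_rel /= eqxx.
rewrite /turn_rel /= xe !inE !negb_or.
by move=> /andP[/and3P[_ -> ->] ->] /and3P[ef -> _]; rewrite eq_sym ef.
Qed.

(** * Graphs with a clique that meets every edge *)

Variable K : {set G}.
Hypothesis cliqueK : {in K &, forall x y, x != y -> sadj x y}.
Hypothesis coverK : forall x y, sadj x y -> (x \in K) || (y \in K).

(** Each [x] in [s] contributes the edge from its predecessor, turning at [x]. *)
Lemma clique_turn_cycle (s : seq G) :
    uniq s -> 2 < size s -> {subset s <= K} ->
  exists2 p, turn_cycle p & size p = size s /\ unzip2 p = s.
Proof.
move=> uniq_s s_gt2 sK.
have neq_np x : x \in s -> next s x != prev s x by exact: next_neq_prev.
pose h x := ([set prev s x; x], x).
have h1_neq x : x \in s -> prev s x != x.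
  move=> xs; apply: contra (neq_np x xs) => /eqP def_x.
  by rewrite -{1}def_x next_prev // def_x.
exists (map h s); last first.
  by split; rewrite ?size_map // /unzip2 -map_comp map_id.
split.
- rewrite cycle_map; apply: cycle_from_next => // x xs /=.
  rewrite /turn_rel /= prev_next // !inE eqxx orbT /= andbT.
  apply/eqP => /setP/(_ (next s x)); rewrite !inE eqxx orbT.
  rewrite (negPf (neq_np x xs)) /= => /eqP nx.
  by have := h1_neq (next s x); rewrite mem_next prev_next // nx eqxx => /(_ xs).
(* If distinct [x] and [y] gave the same edge, each would precede the other, so [y] would be both
   neighbours of [x]. *)
- rewrite /unzip1 -map_comp map_inj_in_uniq // => x y xs ys /= eq_xy.
  apply/eqP; apply: contraT => neq_xy.
  move/setP: (eq_xy) => /(_ x); rewrite !inE eqxx orbT (negPf neq_xy) orbF.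
  move/esym/eqP => def_x.
  move/setP: (eq_xy) => /(_ y).
  rewrite !inE eqxx orbT (eq_sym y x) (negPf neq_xy) orbF.
  move/eqP => def_y.
  by have := neq_np x xs; rewrite -def_y {1}def_x next_prev ?eqxx.
- move=> e /mapP[_ /mapP[x xs ->] ->] /=; apply/edgesP.
  exists (prev s x), x; split=> //; apply: cliqueK; rewrite ?sK ?mem_prev //.
  exact: h1_neq.
Qed.

Lemma clique_cover_line_graph_pancyclic : 2 < #|K| -> pancyclic (line_graph G).
Proof.
move=> K_gt2.
have short k : 2 < k <= #|K| ->
    exists2 p, turn_cycle p & size p = k /\ unzip2 p = take k (enum K).
  case/andP=> k_gt2 k_le.
  have sz : size (take k (enum K)) = k by rewrite size_takel // -cardE.
  have [||x|p tp [sz_p p2]] := @clique_turn_cycle (take k (enum K)).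
  - exact/take_uniq/enum_uniq.
  - by rewrite sz.
  - by move/mem_take; rewrite mem_enum.
  by exists p; rewrite // sz_p.
have long d : #|K| + d <= #|edges G| -> exists2 p, turn_cycle p &
    size p = #|K| + d /\ {subset K <= unzip2 p}.
  elim: d => [|d IHd] le_d.
    have [|p tp [sz p2]] := short #|K|; first by rewrite K_gt2 leqnn.
    exists p; rewrite // addn0; split=> // x xK.
    by rewrite p2 take_oversize ?mem_enum // cardE.
  rewrite addnS in le_d *.
  have [p tp [sz Kp]] := IHd (ltnW le_d).
  have [e eE e_new] : exists2 e, e \in edges G & e \notin unzip1 p.
    apply/subsetPn; apply: contraL le_d => /subset_leq_card le_E.
    rewrite -leqNgt (leq_trans le_E) // (leq_trans (card_size _)) //.
    by rewrite size_map sz.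
  have [x xe xK] : exists2 x, x \in e & x \in K.
    have [x [y [xy ->]]] := edgesP _ eE.
    by case/orP: (coverK xy); [exists x | exists y]; rewrite // !inE eqxx ?orbT.
  have [p' tp' [sz' sub]] := turn_cycle_insert tp eE e_new xe (Kp x xK).
  by exists p'; rewrite // sz' sz; split=> // y /Kp/sub.
have cardL : #|line_graph G| = #|edges G| by rewrite card_sig.
split=> [|k /andP[k_gt2]]; rewrite cardL.
  (* A triangle in [K] already supplies three edges. *)
  have [|p [_ uniq_p sub_p] [sz _]] := short 3; first exact: K_gt2.
  rewrite -sz -(size_map fst) -(card_uniqP uniq_p).
  exact/subset_leq_card/subsetP.
move=> k_le; have [K_ge|K_lt] := leqP k #|K|.
  have [|p tp [<- _]] := short k; first by rewrite k_gt2.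
  exact: turn_cycle_has_cycle.
have := long (k - #|K|); rewrite subnKC ?(ltnW K_lt) // => /(_ k_le)[p tp [<- _]].
exact: turn_cycle_has_cycle.
Qed.

End LineGraphSplit.

(** * Chain rings *)

Section ChainRing.
Local Open Scope ring_scope.
Variable R : finComNzRingType.
Hypothesis chainR : forall x y : R, (exists r, y = x * r) \/ (exists r, x = y * r).

Lemma chain_ring_pancyclic :
    (2 < #|[set x : R | nz_zero_divisor x & (x ^+ 2 != 0)%R]|)%N ->
  pancyclic (line_graph (compl_graph (zero_divisor_graph R))).
Proof.
move=> card_sq.
pose V := {x : R | nz_zero_divisor x}.
pose K : {set compl_graph (zero_divisor_graph R)} :=
  [set x : V | val x ^+ 2 != 0].
(* If [y = x * r], then [y ^+ 2 = x * y * r] vanishes with [x * y]. *)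
have sq_mul (x y : R) : x ^+ 2 != 0 -> y ^+ 2 != 0 -> x * y != 0.
  case: (chainR x y) => -[r ->]; rewrite !expr2 => nx ny.
    by apply: contraNneq ny => xy0; rewrite mulrACA mulrA -(mulrA x x r) xy0 mul0r.
  by apply: contraNneq nx => xy0; rewrite mulrA xy0 mul0r.
(* If [y = x * r], then [x * y = x ^+ 2 * r] vanishes with [x ^+ 2]. *)
have mul_sq (x y : R) : x * y != 0 -> (x ^+ 2 != 0) || (y ^+ 2 != 0).
  case: (chainR x y) => -[r ->] xy0; apply/orP; [left | right].
    by apply: contraNneq xy0 => x0; rewrite mulrA -expr2 x0 mul0r.
  by apply: contraNneq xy0 => y0; rewrite mulrAC -expr2 y0 mul0r.
apply: (@clique_cover_line_graph_pancyclic _ K).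
- move=> x y; rewrite !inE => xK yK neq_xy.
  by rewrite /= /compl_adj neq_xy /= /zdiv_adj neq_xy /= sq_mul.
- move=> x y; rewrite /= /compl_adj /= /zdiv_adj => /andP[neq_xy].
  by rewrite neq_xy /= !inE; exact: mul_sq.
rewrite -(card_imset _ val_inj) (leq_trans card_sq) //.
apply/subset_leq_card/subsetP => x; rewrite inE => /andP[zx x2].
by apply/imsetP; exists (Sub x zx : V); rewrite ?inE.
Qed.

End ChainRing.

(** * Rings whose non-units are the multiples of a nilpotent element *)

Section UniformizerRing.
Local Open Scope ring_scope.
Variables (R : comNzRingType) (t : R) (m : nat).
Hypothesis t_nilp : t ^+ m = 0.
Hypothesis t_local : forall x : R, (exists y, x * y = 1) \/ (exists y, x = t * y).

(** Divide by [t] until the quotient is a unit; if [m] divisions succeed, the element is 0, written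
    as [t ^+ m * 1]. *)
Lemma uniformizer_factor (x : R) :
  exists a u v, x = t ^+ a * u /\ u * v = 1.
Proof.
suff: (exists a u v, x = t ^+ a * u /\ u * v = 1) \/ exists y, x = t ^+ m * y.
  by case=> // -[y ->]; exists m, 1, 1; rewrite t_nilp !mul0r mulr1.
elim: m => [|k [|[y ->]]]; [by right; exists x; rewrite mul1r | by left |].
have [[z yz]|[z ->]] := t_local y; first by left; exists k, y, z.
by right; exists z; rewrite exprSr mulrA.
Qed.

(** The element with the smaller exponent of [t] divides the other. *)
Lemma uniformizer_chain (x y : R) : (exists r, y = x * r) \/ (exists r, x = y * r).
Proof.
have [a [u [u' [-> uu']]]] := uniformizer_factor x.
have [b [v [v' [-> vv']]]] := uniformizer_factor y.
have [le_ab|/ltnW le_ba] := leqP a b; [left | right].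
  exists (u' * t ^+ (b - a) * v).
  by rewrite -!mulrA (mulrA u) uu' mul1r mulrA -exprD subnKC.
exists (v' * t ^+ (a - b) * u).
by rewrite -!mulrA (mulrA v) vv' mul1r mulrA -exprD subnKC.
Qed.

End UniformizerRing.

(** Otherwise some [z] in the field of [q] elements has square -1. Then [z ^+ q = - z], while Fermat
    gives [z ^+ q = z], so [2 z = 0] with [q] odd. *)
Lemma dvdn_sum_squares (q a b : nat) :
  prime q -> q = 3 %[mod 4] -> q %| a ^ 2 + b ^ 2 -> (q %| a) && (q %| b).
Proof.
move=> q_pr q_mod; rewrite !(dvdn_pcharf (pchar_Fp q_pr)) natrD !natrX.
set x := (a%:R)%R; set y := (b%:R)%R => /eqP xy0.
have [y0|ny] := eqVneq y 0%R.
  by move: xy0; rewrite y0 expr0n addr0 => /eqP; rewrite expf_eq0 /= => ->.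
pose z := (x / y)%R.
have z2 : (z ^+ 2 = -1)%R.
  apply/eqP; rewrite -subr_eq0 opprK exprMn exprVn.
  by rewrite -(divff (expf_neq0 2 ny)) -mulrDl xy0 mul0r.
have := expf_card z; rewrite card_Fp //.
have -> : (z ^+ q = - z)%R.
  (* With [k = q %/ 4], the exponent is [q = 2 (2 k + 1) + 1]. *)
  transitivity (z ^+ (2 * (q %/ 4 * 2).+1).+1)%R; first by congr (_ ^+ _)%R; lia.
  by rewrite exprS exprM z2 exprS mulnC exprM sqrrN !expr1n mulr1 mulrN1.
move=> /eqP.
rewrite eq_sym -subr_eq0 opprK -mulr2n -mulr_natl mulf_eq0.
rewrite -(dvdn_pcharf (pchar_Fp q_pr)) dvdn_prime2 // => /orP[/eqP q2|/eqP z0].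
  by rewrite q2 in q_mod.
by move: z2; rewrite z0 expr0n => /eqP; rewrite eq_sym oppr_eq0 oner_eq0.
Qed.

(** * Gaussian integers modulo a power of [q] *)

Section GaussPrimePower.
Local Open Scope ring_scope.
Variables (q m : nat).
Hypotheses (q_pr : prime q) (q_mod : q = 3 %[mod 4]) (m_gt2 : (2 < m)%N).
Local Notation n := (q ^ m)%N.

Lemma gaussZ_natr (k l : nat) : k%:R = GaussZ k%:R 0 :> gaussZ l.
Proof.
elim: k => [//|k IHk]; rewrite -natr1 IHk -[in RHS]natr1.
by congr GaussZ; rewrite /= addr0.
Qed.

Let n_gt1 : (1 < n)%N.
Proof. by rewrite -(exp1n m) ltn_exp2r ?prime_gt1 // ltnW // ltnW. Qed.

Lemma gaussZ_natr_eq0 (k : nat) : (k%:R == 0 :> gaussZ n) = (n %| k)%N.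
Proof.
rewrite gaussZ_natr; apply/eqP/idP => [[/(congr1 val)]|].
  by rewrite /= val_Zp_nat // => /eqP.
move=> n_k; congr GaussZ; apply: val_inj; rewrite /= val_Zp_nat //.
exact/eqP.
Qed.

(** The norm [N] is formed from natural representatives, so that [q] may be tested against it. If
    [q] does not divide [N], the inverse is the conjugate over [N]. *)
Lemma gaussZ_local (x : gaussZ n) :
  (exists y, x * y = 1) \/ (exists y, x = q%:R * y).
Proof.
case: x => a b; pose N := (a ^ 2 + b ^ 2)%N.
have NE : N%:R = a * a + b * b :> 'Z_n.
  by rewrite natrD !natrX !natr_Zp !expr2.
have [q_N|q_N] := boolP (q %| N)%N; [right | left].
  have /andP[/dvdnP[c def_a] /dvdnP[d def_b]] := dvdn_sum_squares q_pr q_mod q_N.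
  exists (GaussZ c%:R d%:R); rewrite gaussZ_natr.
  congr GaussZ; rewrite /= mul0r ?subr0 ?addr0 -natrM mulnC.
    by rewrite -def_a natr_Zp.
  by rewrite -def_b natr_Zp.
have uN : N%:R \is a @GRing.unit 'Z_n.
  by rewrite unitZpE // coprimeXl // prime_coprime.
exists (GaussZ (a / N%:R) (- b / N%:R)).
congr GaussZ; rewrite /= !mulrA mulrN mulNr; last by rewrite (mulrC b) addNr.
by rewrite opprK -mulrDl -NE divrr.
Qed.

Lemma gaussZ_pancyclic :
  pancyclic (line_graph (compl_graph (zero_divisor_graph (gaussZ n)))).
Proof.
have q_gt1 := prime_gt1 q_pr.
have qX_neq0 k : (k < m)%N -> q%:R ^+ k != 0 :> gaussZ n.
  by move=> k_m; rewrite -natrX gaussZ_natr_eq0 dvdn_Pexp2l // -ltnNge.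
(* This will separate [q] from [- q]: otherwise [q ^ 2] divides [2 q], forcing [q = 2]. *)
have q2_neq0 : (q%:R *+ 2 != 0 :> gaussZ n).
  rewrite -mulrnA gaussZ_natr_eq0; apply: contraL (m_gt2) => n_q2.
  have : (q ^ 2 %| q * 2)%N.
    by apply: dvdn_trans n_q2; rewrite dvdn_exp2l // ltnW.
  rewrite -mulnn dvdn_pmul2l ?prime_gt0 // dvdn_prime2 // => /eqP q2.
  by move: q_mod; rewrite q2.
have qm0 : q%:R ^+ m = 0 :> gaussZ n.
  by apply/eqP; rewrite -natrX gaussZ_natr_eq0.
apply: chain_ring_pancyclic; first exact: uniformizer_chain qm0 gaussZ_local.
have zdiv u : q%:R * u != 0 :> gaussZ n -> nz_zero_divisor (q%:R * u).
  move=> qu; rewrite /nz_zero_divisor qu; apply/existsP.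
  exists (q%:R ^+ m.-1); rewrite qX_neq0 ?prednK ?(ltnW (ltnW m_gt2)) //=.
  rewrite mulrAC -exprS prednK ?(ltnW (ltnW m_gt2)) //.
  by rewrite qm0 mul0r.
pose i := gaussZ_i n; pose Q : gaussZ n := q%:R.
(* For [u] among 1, -1 and [i], the square of [Q * u] is [Q ^+ 2] up to sign, nonzero as [m > 2]. *)
have sub : [set Q; - Q; Q * i] \subset
    [set x : gaussZ n | nz_zero_divisor x & x ^+ 2 != 0].
  have Q2 := qX_neq0 2%N m_gt2.
  have inS u : u ^+ 2 = 1 \/ u ^+ 2 = -1 ->
      Q * u \in [set x : gaussZ n | nz_zero_divisor x & x ^+ 2 != 0].
    move=> u2; have Qu2 : (Q * u) ^+ 2 != 0.
      by rewrite exprMn; case: u2 => ->; rewrite ?mulr1 ?mulrN1 ?oppr_eq0.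
    rewrite inE Qu2 andbT zdiv //; apply: contraNneq Qu2 => ->.
    by rewrite expr0n.
  rewrite !subUset !sub1set -[X in X \in _]mulr1 -[- Q]mulrN1 !inS //.
  - by right; exact: gaussZ_sqr_i.
  - by left; rewrite sqrrN expr1n.
  - by left; rewrite expr1n.
apply: leq_trans (subset_leq_card sub).
(* Multiplying [Q * i = Q] or [Q * i = - Q] by [i] again yields [Q = - Q]. *)
have Qii : Q * i * i = - Q by rewrite -mulrA gaussZ_sqr_i mulrN1.
have QN : Q != - Q by rewrite -subr_eq0 opprK -mulr2n.
have QiQ : Q * i != Q by apply: contra_neq QN => Qi; rewrite -Qii !Qi.
have QiN : Q * i != - Q.
  by apply: contra_neq QN => Qi; rewrite -Qii Qi mulNr Qi opprK.
by rewrite setUC cardsU1 cards2 !inE negb_or QiQ QiN QN.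
Qed.

End GaussPrimePower.

Theorem theorem5p2 (q m n : nat) :
  prime q -> q = 3 %[mod 4] -> 3 <= m -> n = q ^ m ->
  pancyclic (line_graph (compl_graph (zero_divisor_graph (gaussZ n)))).
Proof. by move=> q_pr q_mod m_gt2 ->; exact: gaussZ_pancyclic. Qed.
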